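(* Fix an integer $b\ge2$ and $\lambda\in(1/b,1)$, and let $\phi:\mathbb{R}\to\mathbb{R}$ be $\mathbb{Z}$-periodic and of class $C^5$. Then exactly one of the following holds: (i) $W=W^\phi_{\lambda,b}$ is $C^5$ and $\phi$ satisfies condition (H$^*$); (ii) $W$ is not Lipschitz and $\phi$ satisfies condition (H).
   Context: $W^\phi_{\lambda,b}(x)=\sum_{n\ge0}\lambda^n\phi(b^nx)$. Let $\Lambda=\{0,1,\dots,b-1\}$, $\Sigma=\Lambda^{\mathbb{Z}_+}$, $\gamma=1/(b\lambda)\in(1/b,1)$. For a $\mathbb{Z}$-periodic $C^1$ function $\phi$ and $\mathbf{j}=j_1j_2\cdots\in\Sigma$, define $Y(x,\mathbf{j})=-\sum_{n=1}^\infty\gamma^n\phi'\!\left(\frac{x}{b^n}+\frac{j_1}{b^n}+\frac{j_2}{b^{n-1}}+\cdots+\frac{j_n}{b}\right)$, $x\in\mathbb{R}$. Condition (H): for all $\mathbf{i}\ne\mathbf{j}$ in $\Sigma$, the function $x\mapsto Y(x,\mathbf{j})-Y(x,\mathbf{i})$ is not identically zero. Condition (H$^*$): $Y(x,\mathbf{j})-Y(x,\mathbf{i})\equiv0$ for all $\mathbf{i},\mathbf{j}\in\Sigma$. *)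

(* Defs.v *)
From Stdlib Require Import Reals.
From Coquelicot Require Import Coquelicot.
Open Scope R_scope.

Definition C_k (k : nat) (f : R -> R) : Prop :=
  (forall m : nat, (m < k)%nat -> forall x : R, ex_derive (Derive_n f m) x) /\
  (forall x : R, continuous (Derive_n f k) x).

Definition Z_periodic (f : R -> R) : Prop := forall x : R, f (x + 1) = f x.

Definition W (phi : R -> R) (lam : R) (b : nat) (x : R) : R :=
  Series (fun n : nat => lam ^ n * phi (INR b ^ n * x)).

(* Elements of Sigma = Lambda^{Z+}: digit sequences, 0-indexed:
   (j 0, j 1, ...) stands for (j_1, j_2, ...). *)
Definition digit_seq (b : nat) (j : nat -> nat) : Prop :=
  forall i : nat, (j i < b)%nat.

(* Y(x, j) = - sum_{n>=1} gamma^n phi'(x/b^n + j_1/b^n + ... + j_n/b),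
   gamma = 1/(b lambda).  The summation index m corresponds to n = m+1,
   and j_k = j (k-1), so j_k / b^(n-k+1) = j i / b^(m+1-i) with i = k-1. *)
Definition Y (phi : R -> R) (lam : R) (b : nat) (x : R) (j : nat -> nat) : R :=
  let gam := 1 / (INR b * lam) in
  - Series (fun m : nat =>
      gam ^ (S m) *
      Derive phi (x / INR b ^ (S m) +
                  sum_f_R0 (fun i => INR (j i) / INR b ^ (S m - i)) m)).

Definition cond_H (phi : R -> R) (lam : R) (b : nat) : Prop :=
  forall i j : nat -> nat, digit_seq b i -> digit_seq b j -> i <> j ->
    ~ (forall x : R, Y phi lam b x j - Y phi lam b x i = 0).

Definition cond_Hstar (phi : R -> R) (lam : R) (b : nat) : Prop :=
  forall i j : nat -> nat, digit_seq b i -> digit_seq b j ->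
    forall x : R, Y phi lam b x j - Y phi lam b x i = 0.

Definition Lipschitz (f : R -> R) : Prop :=
  exists L : R, forall x y : R, Rabs (f x - f y) <= L * Rabs (x - y).

(* Main.v *)
(** Write [h] for [phi'].  If [W] is Lipschitz, iterating
    [W x = (W ((x + k) / b) - phi ((x + k) / b)) / lam] along the digits [th]
    writes [W x - W 0] as a primitive of [Y (., th)], whatever [th] is: this is
    (H* ).  Conversely, under (H* ) the primitive of [Y (., 0)] is periodic and
    satisfies the functional equation of [W], so [W' = Y (., 0)] is [C^4].

    There remains to see that [Y (., i) = Y (., j)] with [i <> j] forces (H* ).
    Conditioning [Y] on its first [s] digits (an average over the translates
    [x + b^s k]) gives a function of [z = x + (i_1 + ... + i_s b^(s-1))] which
    has the period [d_s], the difference of the [s]-th truncations of [j] and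
    [i].  The increments of this martingale are rescaled copies of a single
    1-periodic continuous function [u], which has therefore the periods
    [d_s / b^s].  As the [b]-adic integers are torsion free, these periods
    generate a dense group, so [u] is constant, and [Y] is digit independent. *)

Require Import Defs.
From Stdlib Require Import Reals Lra Lia ZArith Znumtheory Zpow_facts.
From Stdlib Require Import Classical FunctionalExtensionality.
From Coquelicot Require Import Coquelicot.
Open Scope R_scope.

(** * Geometrically dominated series *)

(** The upper bound is exclusive, so the empty sum is available and [psum a n] is exactly
    complementary to the tail that starts at rank [n]; [sum_f_R0] always contains the term of rank
    0. *)
Fixpoint psum (a : nat -> R) (n : nat) : R :=
  match n with O => 0 | S n => psum a n + a n end.

Lemma psum_ext (a c : nat -> R) (n : nat) :
  (forall k, (k < n)%nat -> a k = c k) -> psum a n = psum c n.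
Proof.
  induction n as [|n IH]; intros H; simpl; auto.
  rewrite IH, H; auto.
Qed.

Lemma psum_plus (a : nat -> R) (m n : nat) :
  psum a (m + n) = psum a m + psum (fun k => a (m + k)%nat) n.
Proof.
  induction n as [|n IH]; simpl.
  - rewrite Nat.add_0_r; ring.
  - rewrite Nat.add_succ_r; simpl; rewrite IH; ring.
Qed.

Lemma psum_shift (a : nat -> R) (n : nat) :
  psum (fun k => a (S k)) n = psum a n + a n - a 0%nat.
Proof. induction n as [|n IH]; simpl; [ring | rewrite IH; ring]. Qed.

Lemma psum_scal (a : nat -> R) (c : R) (n : nat) :
  psum (fun k => c * a k) n = c * psum a n.
Proof. induction n as [|n IH]; simpl; [ring | rewrite IH; ring]. Qed.

Lemma psum_affine (a : nat -> R) (c d : R) (n : nat) :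
  psum (fun k => d + c * a k) n = INR n * d + c * psum a n.
Proof.
  induction n as [|n IH]; [simpl; ring|].
  rewrite S_INR; simpl; rewrite IH; ring.
Qed.

Lemma psum_Rabs (a : nat -> R) (M : R) (n : nat) :
  (forall k, Rabs (a k) <= M) -> Rabs (psum a n) <= INR n * M.
Proof.
  intros H; induction n as [|n IH]; [simpl; rewrite Rabs_R0; lra|].
  rewrite S_INR; simpl.
  apply Rle_trans with (1 := Rabs_triang _ _). specialize (H n); lra.
Qed.

Lemma Series_psum (a : nat -> R) (n : nat) :
  ex_series a -> Series a = psum a n + Series (fun k => a (n + k)%nat).
Proof.
  intros H; induction n as [|n IH]; simpl.
  - rewrite Rplus_0_l; reflexivity.
  - rewrite IH, (Series_incr_1 (fun k => a (n + k)%nat)), Nat.add_0_r.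
    + rewrite (Series_ext _ (fun k => a (S (n + k)))); [ring|].
      intros k; f_equal; lia.
    + now apply (ex_series_incr_n a n).
Qed.

Section GeometricDomination.
Variables (K q : R).
Hypothesis q_pos : 0 <= q.
Hypothesis q_lt1 : q < 1.

Lemma Rabs_q : Rabs q < 1.
Proof. rewrite Rabs_pos_eq; lra. Qed.

Lemma ex_series_dom (a : nat -> R) :
  (forall n, Rabs (a n) <= K * q ^ n) -> ex_series a.
Proof.
  intros H. apply (ex_series_le a (fun n => K * q ^ n)); [exact H|].
  apply (ex_series_scal K (fun n => q ^ n)).
  exists (/ (1 - q)). apply is_series_geom, Rabs_q.
Qed.

Lemma Series_dom (a : nat -> R) :
  (forall n, Rabs (a n) <= K * q ^ n) -> Rabs (Series a) <= K / (1 - q).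
Proof.
  intros H.
  assert (Hg : ex_series (fun n => K * q ^ n)).
  { apply ex_series_dom. intros n. rewrite Rabs_pos_eq; [lra|].
    apply Rle_trans with (2 := H n), Rabs_pos. }
  apply Rle_trans with (Series (fun n => Rabs (a n))).
  - apply Series_Rabs.
    apply (ex_series_le (fun n => Rabs (a n)) (fun n => K * q ^ n)); [|exact Hg].
    intros n. change (Rabs (Rabs (a n)) <= K * q ^ n). rewrite Rabs_Rabsolu. auto.
  - apply Rle_trans with (Series (fun n => K * q ^ n)).
    + apply Series_le; [|exact Hg]. intros n; split; [apply Rabs_pos | auto].
    + rewrite Series_scal_l, Series_geom by apply Rabs_q. unfold Rdiv; lra.
Qed.

Lemma Series_tail_dom (a : nat -> R) (N : nat) :
  (forall n, Rabs (a n) <= K * q ^ n) ->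
  Rabs (Series a - psum a N) <= K / (1 - q) * q ^ N.
Proof.
  intros H. rewrite (Series_psum a N) by now apply ex_series_dom.
  replace (psum a N + _ - _) with (Series (fun k => a (N + k)%nat)) by ring.
  (* Once [q ^ N] is factored out, the tail is again dominated by [K * q ^ n]. Since [q] may be 0,
     the case [q ^ N = 0] is treated apart: the domination then makes every term of the tail
     vanish. *)
  rewrite (Series_ext _ (fun k => q ^ N * (/ q ^ N * a (N + k)%nat))).
  - rewrite Series_scal_l, Rabs_mult, Rabs_pos_eq by now apply pow_le.
    destruct (Req_dec (q ^ N) 0) as [E|E].
    { rewrite E; lra. }
    rewrite Rmult_comm. apply Rmult_le_compat_r; [now apply pow_le|].
    apply Series_dom. intros n. rewrite Rabs_mult, Rabs_inv.
    rewrite (Rabs_pos_eq (q ^ N)) by now apply pow_le.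
    apply Rmult_le_reg_l with (q ^ N).
    + assert (0 <= q ^ N) by now apply pow_le. lra.
    + specialize (H (N + n)%nat). rewrite pow_add in H.
      field_simplify; [lra | exact E].
  - intros n. destruct (Req_dec (q ^ N) 0) as [E|E]; [|now field].
    specialize (H (N + n)%nat). rewrite pow_add, E, Rmult_0_l, Rmult_0_r in H.
    assert (a (N + n)%nat = 0); [|rewrite E; lra].
    apply Rabs_eq_0. generalize (Rabs_pos (a (N + n)%nat)). lra.
Qed.

Lemma geom_small (eps : R) : 0 < eps -> exists N, Rabs K / (1 - q) * q ^ N < eps.
Proof.
  intros He.
  (* The [+ 1] keeps the divisor positive when [K = 0]. *)
  destruct (pow_lt_1_zero q Rabs_q (eps / (Rabs K / (1 - q) + 1))) as [N HN].
  - apply Rdiv_lt_0_compat; [lra|].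
    assert (0 <= Rabs K / (1 - q)); [|lra].
    apply Rdiv_le_0_compat; [apply Rabs_pos | lra].
  - exists N. specialize (HN N (le_n N)). rewrite Rabs_pos_eq in HN by now apply pow_le.
    assert (H0 : 0 <= Rabs K / (1 - q)).
    { apply Rdiv_le_0_compat; [apply Rabs_pos | lra]. }
    apply Rle_lt_trans with ((Rabs K / (1 - q) + 1) * q ^ N).
    + apply Rmult_le_compat_r; [now apply pow_le | lra].
    + apply Rmult_lt_compat_l with (r := Rabs K / (1 - q) + 1) in HN; [|lra].
      replace eps with ((Rabs K / (1 - q) + 1) * (eps / (Rabs K / (1 - q) + 1))) at 1; [exact HN|].
      field; generalize (Rabs_pos K); split; lra.
Qed.

Lemma continuous_psum (f : nat -> R -> R) (x : R) (n : nat) :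
  (forall n, continuous (f n) x) -> continuous (fun y => psum (fun k => f k y) n) x.
Proof.
  intros H; induction n as [|n IH]; simpl.
  - apply continuous_const.
  - now apply (continuous_plus (fun y => psum (fun k => f k y) n) (f n)).
Qed.

Lemma continuous_Series (f : nat -> R -> R) (x : R) :
  (forall n, continuous (f n) x) ->
  (forall n y, Rabs (f n y) <= K * q ^ n) ->
  continuous (fun y => Series (fun n => f n y)) x.
Proof.
  intros Hc Hd.
  apply continuity_pt_filterlim, continuity_pt_locally. intros eps.
  destruct (geom_small (eps / 3)) as [N HN]; [destruct eps; simpl; lra|].
  assert (HK : forall y, Rabs (Series (fun n => f n y) - psum (fun n => f n y) N) < eps / 3).
  { intros y. apply Rle_lt_trans with (2 := HN).
    apply Rle_trans with (1 := Series_tail_dom _ N (fun n => Hd n y)).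
    apply Rmult_le_compat_r; [now apply pow_le|].
    apply Rmult_le_compat_r; [left; apply Rinv_0_lt_compat; lra | apply Rle_abs]. }
  assert (He : 0 < eps / 3) by (destruct eps; simpl; lra).
  generalize (continuous_psum f x N Hc). intros Hp.
  apply continuity_pt_filterlim in Hp. rewrite continuity_pt_locally in Hp.
  generalize (Hp (mkposreal _ He)). apply filter_imp. intros y Hy. simpl in Hy.
  generalize (HK y) (HK x).
  revert Hy. unfold Rabs. repeat destruct Rcase_abs; lra.
Qed.

End GeometricDomination.

(** The difference quotients at [x], extended by [f' n x] at [x] itself, are continuous at [x] and,
    by the mean value theorem, dominated by [K * q ^ n]. Their sum is therefore continuous at [x],
    which is the differentiability of the series. *)
Lemma is_derive_Series (K q : R) (f f' : nat -> R -> R) (x : R) :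
  0 <= q < 1 ->
  (forall n y, is_derive (f n) y (f' n y)) ->
  (forall n y, Rabs (f' n y) <= K * q ^ n) ->
  (forall y, ex_series (fun n => f n y)) ->
  is_derive (fun y => Series (fun n => f n y)) x (Series (fun n => f' n x)).
Proof.
  intros Hq Hd Hb He.
  set (g := fun n y => if Req_EM_T y x then f' n x else (f n y - f n x) / (y - x)).
  assert (Hg : continuous (fun y => Series (fun n => g n y)) x).
  { apply (continuous_Series K q); try lra.
    - intros n. apply continuity_pt_filterlim, continuity_pt_locally. intros eps.
      generalize (Hd n x). rewrite is_derive_Reals. intros H.
      destruct (H eps (cond_pos eps)) as [delta Hdel].
      exists delta. intros y Hy. unfold g at 2.
      destruct (Req_EM_T x x) as [_|E]; [|lra]. unfold g.
      destruct (Req_EM_T y x) as [->|E].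
      { rewrite Rminus_diag, Rabs_R0. apply cond_pos. }
      specialize (Hdel (y - x)). replace (x + (y - x)) with y in Hdel by (simpl; lra).
      apply Hdel; [lra|]. exact Hy.
    - intros n y. unfold g. destruct (Req_EM_T y x) as [->|E]; [apply Hb|].
      destruct (MVT_gen (f n) x y (f' n)) as [c [_ Hc]].
      + intros; apply Hd.
      + intros z _. apply continuity_pt_filterlim. apply (ex_derive_continuous (f n)).
        eexists; apply Hd.
      + rewrite Hc. replace (_ / _) with (f' n c); [apply Hb | field; lra]. }
  apply is_derive_Reals. intros eps Heps.
  apply continuity_pt_filterlim in Hg. rewrite continuity_pt_locally in Hg.
  destruct (Hg (mkposreal eps Heps)) as [delta Hdel].
  exists delta. intros h Hh Hhd. simpl in Hdel.
  specialize (Hdel (x + h)).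
  replace ((Series (fun n => f n (x + h)) - Series (fun n => f n x)) / h)
    with (Series (fun n => g n (x + h))).
  - rewrite (Series_ext (fun n => f' n x) (fun n => g n x)).
    + apply Hdel. change (Rabs (x + h - x) < delta).
      now replace (x + h - x) with h by lra.
    + intros n; unfold g. destruct (Req_EM_T x x); [reflexivity | lra].
  - rewrite <- Series_minus by auto.
    unfold Rdiv. rewrite Rmult_comm, <- Series_scal_l. apply Series_ext.
    intros n; unfold g. destruct (Req_EM_T (x + h) x); [lra|].
    now field.
Qed.

(** * Periods *)

Definition period (f : R -> R) (t : R) : Prop := forall x, f (x + t) = f x.

Lemma period_opp (f : R -> R) (t : R) : period f t -> period f (- t).
Proof. intros H x. rewrite <- (H (x + - t)). f_equal; ring. Qed.

Lemma period_plus (f : R -> R) (s t : R) :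
  period f s -> period f t -> period f (s + t).
Proof. intros Hs Ht x. now rewrite <- Rplus_assoc, Ht. Qed.

Lemma period_nat (f : R -> R) (t : R) (n : nat) : period f t -> period f (INR n * t).
Proof.
  intros H; induction n as [|n IH].
  - intros x; simpl; f_equal; ring.
  - rewrite S_INR, Rmult_plus_distr_r, Rmult_1_l. now apply period_plus.
Qed.

Lemma period_Z (f : R -> R) (t : R) (k : Z) : period f t -> period f (IZR k * t).
Proof.
  intros H; destruct k as [|p|p].
  - exact (period_nat f t 0 H).
  - rewrite <- positive_nat_Z, <- INR_IZR_INZ. now apply period_nat.
  - change (Z.neg p) with (- Z.pos p)%Z.
    rewrite opp_IZR, Ropp_mult_distr_l_reverse, <- positive_nat_Z, <- INR_IZR_INZ.
    now apply period_opp, period_nat.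
Qed.

Lemma floor_ex (x : R) : exists k : Z, 0 <= x - IZR k < 1.
Proof. destruct (archimed x). exists (up x - 1)%Z. rewrite minus_IZR. lra. Qed.

Lemma periodic_bounded (f : R -> R) :
  Z_periodic f -> (forall x, continuous f x) -> exists M, forall x, Rabs (f x) <= M.
Proof.
  intros Hp Hc.
  destruct (bounded_continuity f 0 1) as [M HM]; [intros; apply Hc|].
  exists M. intros x. destruct (floor_ex x) as [k Hk].
  rewrite <- (period_Z f 1 (- k) Hp x), opp_IZR. left. apply HM. lra.
Qed.

(** A multiple of the period [/ IZR q] brings [x] into [0, 1/q). As [q] can be taken arbitrarily
    large, continuity at 0 alone concludes. *)
Lemma constant_of_small_periods (u : R -> R) :
  (forall x, continuous u x) ->
  (forall n : nat, exists q : Z, (Z.of_nat n <= q)%Z /\ (1 <= q)%Z /\ period u (/ IZR q)) ->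
  forall x, u x = u 0.
Proof.
  intros Hc Hq x. apply cond_eq. intros eps Heps.
  generalize (Hc 0). intros H0.
  apply continuity_pt_filterlim in H0. rewrite continuity_pt_locally in H0.
  destruct (H0 (mkposreal eps Heps)) as [delta Hd]. simpl in Hd.
  destruct (nfloor_ex (/ delta)) as [n Hn].
  { left. apply Rinv_0_lt_compat, cond_pos. }
  destruct (Hq (S n)) as [q [Hnq [Hq1 Hper]]].
  apply IZR_le in Hnq. rewrite <- INR_IZR_INZ, S_INR in Hnq.
  apply IZR_le in Hq1.
  destruct (floor_ex (x * IZR q)) as [k Hk].
  rewrite <- (period_Z u _ (- k) Hper x). rewrite opp_IZR.
  apply Hd. change (Rabs (x + - IZR k * / IZR q - 0) < delta).
  replace (x + - IZR k * / IZR q - 0) with ((x * IZR q - IZR k) * / IZR q) by (field; lra).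
  assert (Hi : 0 < / IZR q) by (apply Rinv_0_lt_compat; lra).
  rewrite Rabs_pos_eq by (apply Rmult_le_pos; lra).
  apply Rlt_le_trans with (1 * / IZR q); [apply Rmult_lt_compat_r; lra|].
  rewrite Rmult_1_l, <- (Rinv_inv delta).
  apply Rinv_le_contravar; [apply Rinv_0_lt_compat, cond_pos | lra].
Qed.

(** Let g = gcd(B, qa) and B = kg. Dividing a Bezout relation for g by qB writes g/(qB) = 1/(qk) as
    an integer combination of 1/q and a/B, and k > 1 because B does not divide qa. *)
Lemma period_refine (u : R -> R) (q a B : Z) :
  (1 <= q)%Z -> (1 <= B)%Z -> ~ (B | q * a)%Z ->
  period u (/ IZR q) -> period u (IZR a / IZR B) ->
  exists q' : Z, (q < q')%Z /\ period u (/ IZR q').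
Proof.
  intros Hq HB Hn Hp1 Hp2.
  destruct (Zis_gcd_bezout _ _ _ (Zgcd_is_gcd B (q * a))) as [al be Hbez].
  destruct (Z.gcd_divide_l B (q * a)) as [k Hk].
  set (g := Z.gcd B (q * a)) in *.
  assert (Hg : (0 < g)%Z).
  { assert (0 <= g)%Z by apply Z.gcd_nonneg.
    assert (g <> 0)%Z by (intros E; rewrite E, Z.mul_0_r in Hk; lia). lia. }
  assert (Hk1 : (1 < k)%Z).
  { assert (k <> 1)%Z; [|nia]. intros ->. apply Hn.
    rewrite Hk, Z.mul_1_l. apply Z.gcd_divide_r. }
  exists (q * k)%Z. split; [nia|].
  replace (/ IZR (q * k)) with (IZR al * / IZR q + IZR be * (IZR a / IZR B)).
  - apply period_plus; now apply period_Z.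
  - apply (f_equal IZR) in Hbez, Hk. rewrite plus_IZR, !mult_IZR in *.
    apply IZR_lt in Hg, Hk1. apply IZR_le in Hq, HB.
    apply Rmult_eq_reg_l with (IZR q * IZR B); [|nra].
    transitivity (IZR al * IZR B + IZR be * (IZR q * IZR a)); [field; lra|].
    rewrite Hbez, Hk. field; lra.
Qed.

(* The [b]-adic integers are torsion free. *)
Lemma torsion_free (b : Z) (c d : nat -> Z) :
  (2 <= b)%Z ->
  (forall s, d (S s) = d s + c s * b ^ Z.of_nat s)%Z ->
  forall q : Z, (1 <= q)%Z ->
  (forall s, (b ^ Z.of_nat s | q * d s)%Z) ->
  forall s, (b ^ Z.of_nat s | d s)%Z.
Proof.
  intros Hb Hd q Hq. revert q Hq.
  assert (H : forall n q, (1 <= q <= Z.of_nat n)%Z ->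
    (forall s, (b ^ Z.of_nat s | q * d s)%Z) -> forall s, (b ^ Z.of_nat s | d s)%Z).
  2: { intros q Hq. apply (H (Z.to_nat q)). lia. }
  induction n as [|n IH]; intros q Hq Hdiv; [lia|].
  (* The induction is on a bound [n] for [q]. If [q] is prime to [b], it can be cancelled at once by
     Gauss; otherwise the common factor [g] is removed from [q]. *)
  destruct (Z.eq_dec (Z.gcd q b) 1) as [E|E].
  { intros s. apply Gauss with q; [apply Hdiv|].
    apply rel_prime_sym, rel_prime_Zpower_r; [lia|].
    now apply Zgcd_1_rel_prime. }
  destruct (Z.gcd_divide_l q b) as [q' Hq'], (Z.gcd_divide_r q b) as [b' Hb'].
  set (g := Z.gcd q b) in *.
  assert (Hg : (2 <= g)%Z).
  { assert (0 <= g)%Z by apply Z.gcd_nonneg.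
    assert (g <> 0)%Z by (intros E0; rewrite E0 in Hb'; lia). lia. }
  (* Divisibility at rank [S s], divided by [g], still leaves [b ^ s] dividing [q' * d (S s)], and
     [d (S s)] is congruent to [d s] modulo [b ^ s]. *)
  apply (IH q'); [nia|]. intros s.
  destruct (Hdiv (S s)) as [m Hm].
  rewrite Nat2Z.inj_succ, Z.pow_succ_r in Hm by lia.
  assert (H : (q' * d (S s) = m * b' * b ^ Z.of_nat s)%Z).
  { apply Z.mul_reg_l with g; [lia|].
    transitivity (q * d (S s))%Z; [rewrite Hq' at 1; ring|].
    rewrite Hm. rewrite Hb' at 1. ring. }
  rewrite Hd in H. exists (m * b' - q' * c s)%Z.
  rewrite Z.mul_add_distr_l in H. lia.
Qed.

(** * Inverse branches and transfer series *)

(** Iterating the identity along [tau] gives |D x| <= M q^n for all n. This is the uniqueness of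
    bounded solutions of the functional equations below. *)
Lemma contraction_zero (X : Type) (tau : X -> X) (D : X -> R) (q M : R) :
  0 <= q < 1 ->
  (forall x, D x = q * D (tau x)) ->
  (forall x, Rabs (D x) <= M) -> forall x, D x = 0.
Proof.
  intros Hq Hc HM x.
  assert (Hn : forall n x, Rabs (D x) <= M * q ^ n).
  { induction n as [|n IH]; intros y; simpl; [rewrite Rmult_1_r; apply HM|].
    rewrite Hc, Rabs_mult, (Rabs_pos_eq q) by lra.
    replace (M * (q * q ^ n)) with (q * (M * q ^ n)) by ring.
    now apply Rmult_le_compat_l. }
  apply cond_eq. intros eps Heps. rewrite Rminus_0_r.
  assert (Hq' : Rabs q < 1) by (rewrite Rabs_pos_eq; lra).
  destruct (pow_lt_1_zero q Hq' (eps / (Rabs M + 1))) as [N HN].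
  { apply Rdiv_lt_0_compat; generalize (Rabs_pos M); lra. }
  specialize (HN N (le_n N)). rewrite Rabs_pos_eq in HN by (apply pow_le; lra).
  apply Rle_lt_trans with (1 := Hn N x).
  apply Rle_lt_trans with ((Rabs M + 1) * q ^ N).
  - apply Rmult_le_compat_r; [apply pow_le; lra|]. generalize (Rle_abs M); lra.
  - apply Rmult_lt_compat_l with (r := Rabs M + 1) in HN; [|generalize (Rabs_pos M); lra].
    replace eps with ((Rabs M + 1) * (eps / (Rabs M + 1))) at 1; [exact HN|].
    field; generalize (Rabs_pos M); lra.
Qed.

Definition drop_digits (th : nat -> nat) (s : nat) : nat -> nat := fun i => th (s + i)%nat.

Section Base.
Variable b : nat.
Hypothesis Hb : (2 <= b)%nat.

Fixpoint expansion (th : nat -> nat) (n : nat) : nat :=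
  match n with O => O | S n => expansion th n + th n * b ^ n end.

Lemma expansion_plus (th : nat -> nat) (s n : nat) :
  (expansion th (s + n) = expansion th s + b ^ s * expansion (drop_digits th s) n)%nat.
Proof.
  clear Hb. induction n as [|n IH]; simpl.
  - rewrite Nat.add_0_r; lia.
  - rewrite Nat.add_succ_r; simpl. rewrite IH, Nat.pow_add_r. unfold drop_digits; lia.
Qed.

Lemma expansion_0 (n : nat) : expansion (fun _ => O) n = O.
Proof. clear Hb. induction n as [|n IH]; simpl; lia. Qed.

Lemma expansion_lt (th : nat -> nat) (n : nat) :
  digit_seq b th -> (expansion th n < b ^ n)%nat.
Proof.
  clear Hb. intros H; induction n as [|n IH]; simpl; [lia|].
  specialize (H n). nia.
Qed.

(** A composite of [n] inverse branches of x -> bx mod 1, selected by the digits. It is the argument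
    of phi' in the term of order n of [Y], put over the common denominator b^n. *)
Definition branch (th : nat -> nat) (n : nat) (x : R) : R :=
  (x + INR (expansion th n)) / INR b ^ n.

Lemma INR_b_ge2 : 2 <= INR b.
Proof. apply (le_INR 2 b Hb). Qed.

Lemma pow_b_pos (n : nat) : 0 < INR b ^ n.
Proof. apply pow_lt. generalize INR_b_ge2; lra. Qed.

Lemma branch_plus (th : nat -> nat) (s n : nat) (x : R) :
  branch th (s + n) x = branch (drop_digits th s) n (branch th s x).
Proof.
  unfold branch. rewrite expansion_plus, plus_INR, mult_INR, pow_INR, pow_add.
  generalize (pow_b_pos s) (pow_b_pos n); intros. field; lra.
Qed.

(** The digits of rank at least [n] contribute a multiple of b^n to the numerator, hence an integer
    translation, which [f] ignores. *)
Lemma branch_truncate (f : R -> R) (th : nat -> nat) (s n : nat) (x : R) :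
  Z_periodic f -> (n <= s)%nat ->
  f (branch th n x) = f ((x + INR (expansion th s)) / INR b ^ n).
Proof.
  intros Hf Hn. replace s with (n + (s - n))%nat by lia.
  rewrite expansion_plus, plus_INR, mult_INR, pow_INR.
  set (k := expansion _ (s - n)). unfold branch.
  rewrite <- (period_nat f 1 k Hf). f_equal.
  generalize (pow_b_pos n); intros. field; lra.
Qed.

Lemma is_derive_branch (f f' : R -> R) (th : nat -> nat) (n : nat) (x : R) :
  (forall y, is_derive f y (f' y)) ->
  is_derive (fun x => f (branch th n x)) x (f' (branch th n x) / INR b ^ n).
Proof.
  intros H.
  replace (f' (branch th n x) / INR b ^ n) with (/ INR b ^ n * f' (branch th n x))
    by (unfold Rdiv; ring).
  apply (is_derive_comp f (branch th n) x); [apply H|].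
  unfold branch. auto_derive; [auto|].
  generalize (pow_b_pos n); intros. field; lra.
Qed.

Lemma branch_sub (th : nat -> nat) (n : nat) (x y : R) :
  branch th n x - branch th n y = (x - y) / INR b ^ n.
Proof. unfold branch. generalize (pow_b_pos n); intros. field; lra. Qed.

(** Up to sign this is [Y] for g = gamma and h = phi'. The weight and the function are left free so
    that the derivatives of [Y] are series of the same kind. *)
Definition transfer (g : R) (h : R -> R) (th : nat -> nat) (x : R) : R :=
  Series (fun n => g ^ S n * h (branch th (S n) x)).

(** The number of summands is separated from [m], which fixes the denominators, to allow an
    induction on [k]; the case k = m is the one that occurs in [Y]. *)
Lemma sum_digits (th : nat -> nat) (m k : nat) :
  (k <= m)%nat ->
  sum_f_R0 (fun i => INR (th i) / INR b ^ (S m - i)) k =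
  INR (expansion th (S k)) / INR b ^ S m.
Proof.
  assert (Haux : forall k, (k <= m)%nat ->
    INR (th k) / INR b ^ (S m - k) = INR (th k * b ^ k) / INR b ^ S m).
  { clear k; intros k Hk. rewrite mult_INR, pow_INR.
    replace (INR b ^ S m) with (INR b ^ (S m - k) * INR b ^ k).
    - generalize (pow_b_pos k) (pow_b_pos (S m - k)); intros. field; lra.
    - rewrite <- pow_add. f_equal; lia. }
  induction k as [|k IH]; intros Hk.
  - cbn [sum_f_R0]. rewrite (Haux 0%nat Hk). reflexivity.
  - cbn [sum_f_R0]. rewrite IH, (Haux (S k) Hk) by lia.
    change (expansion th (S (S k))) with (expansion th (S k) + th (S k) * b ^ S k)%nat.
    rewrite plus_INR. unfold Rdiv; ring.
Qed.

Lemma Y_transfer (phi : R -> R) (lam x : R) (th : nat -> nat) :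
  Y phi lam b x th = - transfer (1 / (INR b * lam)) (Derive phi) th x.
Proof.
  unfold Y, transfer. f_equal. apply Series_ext. intros m.
  rewrite sum_digits by lia. unfold branch. do 2 f_equal. unfold Rdiv; ring.
Qed.

Section Weight.
Variables (g : R) (h : R -> R) (M : R).
Hypothesis Hg : 0 < g < 1.
Hypothesis HM : forall x, Rabs (h x) <= M.

Lemma transfer_term_dom (n : nat) (y : R) : Rabs (g ^ S n * h y) <= (M * g) * g ^ n.
Proof.
  rewrite Rabs_mult, Rabs_pos_eq by (apply pow_le; lra).
  replace (M * g * g ^ n) with (g ^ S n * M) by (simpl; ring).
  apply Rmult_le_compat_l; [apply pow_le; lra | apply HM].
Qed.

Lemma ex_series_transfer (th : nat -> nat) (x : R) :
  ex_series (fun n => g ^ S n * h (branch th (S n) x)).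
Proof. apply (ex_series_dom (M * g) g); try lra. intros; apply transfer_term_dom. Qed.

Lemma transfer_bounded (th : nat -> nat) (x : R) :
  Rabs (transfer g h th x) <= M * g / (1 - g).
Proof. apply Series_dom; try lra. intros; apply transfer_term_dom. Qed.

Lemma transfer_split (th : nat -> nat) (s : nat) (x : R) :
  transfer g h th x =
  psum (fun n => g ^ S n * h (branch th (S n) x)) s +
  g ^ s * transfer g h (drop_digits th s) (branch th s x).
Proof.
  unfold transfer at 1. rewrite (Series_psum _ s) by apply ex_series_transfer.
  f_equal. unfold transfer. rewrite <- Series_scal_l. apply Series_ext. intros n.
  rewrite <- Nat.add_succ_r, pow_add, branch_plus. ring.
Qed.

Lemma transfer_eq (th : nat -> nat) (x : R) :
  transfer g h th x =
  g * h (branch th 1 x) + g * transfer g h (drop_digits th 1) (branch th 1 x).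
Proof. rewrite (transfer_split th 1). simpl. ring. Qed.

Lemma continuous_transfer (th : nat -> nat) (x : R) :
  (forall y, continuous h y) -> continuous (transfer g h th) x.
Proof.
  intros Hc. apply (continuous_Series (M * g) g); try lra.
  - intros n. apply (continuous_scal_r (g ^ S n) (fun y => h (branch th (S n) y))).
    apply (continuous_comp (branch th (S n)) h); [|apply Hc].
    apply (ex_derive_continuous (branch th (S n))). unfold branch. auto_derive. auto.
  - intros; apply transfer_term_dom.
Qed.

End Weight.

(** Differentiating a branch of order n brings out a factor b^(-n), which turns the weight g^n into
    (g/b)^n. *)
Lemma is_derive_transfer (g : R) (h h' : R -> R) (M M' : R) (th : nat -> nat) (x : R) :
  0 < g < 1 ->
  (forall x, Rabs (h x) <= M) -> (forall x, Rabs (h' x) <= M') ->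
  (forall x, is_derive h x (h' x)) ->
  is_derive (transfer g h th) x (transfer (g / INR b) h' th x).
Proof.
  intros Hg HM HM' Hd.
  assert (Hgb : 0 < g / INR b < 1).
  { generalize INR_b_ge2; intros. split; [apply Rdiv_lt_0_compat; lra|].
    apply Rmult_lt_reg_r with (INR b); [lra|]. unfold Rdiv.
    rewrite Rmult_assoc, Rinv_l; lra. }
  apply (is_derive_Series (M' * (g / INR b)) (g / INR b)
    (fun n y => g ^ S n * h (branch th (S n) y))
    (fun n y => (g / INR b) ^ S n * h' (branch th (S n) y))); try lra.
  - intros n y.
    replace ((g / INR b) ^ S n * h' (branch th (S n) y))
      with (g ^ S n * (h' (branch th (S n) y) / INR b ^ S n)).
    + apply (is_derive_scal (fun y => h (branch th (S n) y))). now apply is_derive_branch.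
    + unfold Rdiv. rewrite Rpow_mult_distr, pow_inv. ring.
  - intros n y. now apply transfer_term_dom.
  - intros y. now apply (ex_series_transfer g h M).
Qed.

End Base.

(** * The Weierstrass function *)

Section Weierstrass.
Variables (b : nat) (lam : R) (phi : R -> R) (M0 M1 : R).
Hypothesis Hb : (2 <= b)%nat.
Hypothesis Hlam1 : 1 / INR b < lam.
Hypothesis Hlam2 : lam < 1.
Hypothesis Hper : Z_periodic phi.
Hypothesis Hder : forall x, ex_derive phi x.
Hypothesis HM0 : forall x, Rabs (phi x) <= M0.
Hypothesis HM1 : forall x, Rabs (Derive phi x) <= M1.

Let gam := 1 / (INR b * lam).

Lemma lam_pos : 0 < lam.
Proof.
  generalize (INR_b_ge2 b Hb); intros.
  apply Rlt_trans with (2 := Hlam1). apply Rdiv_lt_0_compat; lra.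
Qed.

Lemma gam_bounds : 0 < gam < 1.
Proof.
  generalize (INR_b_ge2 b Hb) lam_pos; intros. unfold gam.
  assert (1 < INR b * lam).
  { apply Rmult_lt_compat_l with (r := INR b) in Hlam1; [|lra].
    replace (INR b * (1 / INR b)) with 1 in Hlam1 by (field; lra). lra. }
  split; [apply Rdiv_lt_0_compat; lra|].
  apply Rmult_lt_reg_r with (INR b * lam); [lra|].
  unfold Rdiv. rewrite Rmult_assoc, Rinv_l; lra.
Qed.

Lemma phi_lipschitz (x y : R) : Rabs (phi x - phi y) <= M1 * Rabs (x - y).
Proof.
  destruct (MVT_gen phi y x (Derive phi)) as [c [_ Hc]].
  - intros; now apply Derive_correct.
  - intros z _. apply continuity_pt_filterlim. now apply (ex_derive_continuous phi).
  - rewrite Hc, Rabs_mult. apply Rmult_le_compat_r; [apply Rabs_pos | apply HM1].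
Qed.

Lemma W_term_dom (n : nat) (x : R) : Rabs (lam ^ n * phi x) <= M0 * lam ^ n.
Proof.
  rewrite Rabs_mult, Rabs_pos_eq, Rmult_comm by (apply pow_le; generalize lam_pos; lra).
  apply Rmult_le_compat_r; [apply pow_le; generalize lam_pos; lra | apply HM0].
Qed.

Lemma W_bounded (x : R) : Rabs (W phi lam b x) <= M0 / (1 - lam).
Proof. apply Series_dom; generalize lam_pos; try lra. intros; apply W_term_dom. Qed.

Lemma W_eq (x : R) : W phi lam b x = phi x + lam * W phi lam b (INR b * x).
Proof.
  unfold W at 1. rewrite Series_incr_1.
  - simpl. rewrite !Rmult_1_l. f_equal. unfold W. rewrite <- Series_scal_l.
    apply Series_ext. intros n. simpl. rewrite Rmult_assoc. do 2 f_equal. f_equal. ring.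
  - apply (ex_series_dom M0 lam); generalize lam_pos; try lra.
    intros; apply W_term_dom.
Qed.

Lemma W_periodic : Z_periodic (W phi lam b).
Proof.
  intros x. apply Series_ext. intros n. f_equal.
  rewrite <- pow_INR, Rmult_plus_distr_l. exact (period_nat phi 1 (b ^ n) Hper _).
Qed.

(** * A primitive of [Y] along a digit sequence *)

Definition potential_term (th : nat -> nat) (n : nat) (x : R) : R :=
  (/ lam) ^ S n * (phi (branch b th (S n) x) - phi (branch b th (S n) 0)).

(** The primitive of [Y] that vanishes at 0. Subtracting the value at 0 inside each term is what
    makes the series converge: the factor lam^(-n) meets a difference of order b^(-n), and the
    product is of order gamma^n. *)
Definition potential (th : nat -> nat) (x : R) : R :=
  - Series (fun n => potential_term th n x).

Lemma gam_pow (n : nat) : (/ lam) ^ n / INR b ^ n = gam ^ n.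
Proof.
  unfold gam, Rdiv. rewrite Rmult_1_l, Rinv_mult, Rpow_mult_distr, !pow_inv. ring.
Qed.

Lemma potential_term_dom (th : nat -> nat) (n : nat) (x : R) :
  Rabs (potential_term th n x) <= M1 * Rabs x * gam * gam ^ n.
Proof.
  unfold potential_term.
  assert (Hl : 0 < (/ lam) ^ S n) by apply pow_lt, Rinv_0_lt_compat, lam_pos.
  rewrite Rabs_mult, Rabs_pos_eq by lra.
  apply Rle_trans with ((/ lam) ^ S n * (M1 * (Rabs x / INR b ^ S n))).
  - apply Rmult_le_compat_l; [lra|].
    apply Rle_trans with (1 := phi_lipschitz _ _). rewrite branch_sub, Rminus_0_r by exact Hb.
    unfold Rdiv. rewrite Rabs_mult, (Rabs_pos_eq (/ _)); [lra|].
    left; apply Rinv_0_lt_compat, pow_b_pos, Hb.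
  - right.
    replace (M1 * Rabs x * gam * gam ^ n) with (M1 * Rabs x * gam ^ S n) by (simpl; ring).
    rewrite <- gam_pow. unfold Rdiv; ring.
Qed.

Lemma ex_series_potential (th : nat -> nat) (x : R) :
  ex_series (fun n => potential_term th n x).
Proof.
  apply (ex_series_dom (M1 * Rabs x * gam) gam); generalize gam_bounds; try lra.
  intros; apply potential_term_dom.
Qed.

Lemma is_derive_potential (th : nat -> nat) (x : R) :
  is_derive (potential th) x (Y phi lam b x th).
Proof.
  rewrite Y_transfer by exact Hb. fold gam.
  apply (is_derive_opp (fun y => Series (fun n => potential_term th n y))).
  apply (is_derive_Series (M1 * gam) gam _
    (fun n y => gam ^ S n * Derive phi (branch b th (S n) y))).
  - generalize gam_bounds; lra.
  - intros n y. rewrite <- gam_pow.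
    replace (_ * _) with ((/ lam) ^ S n *
      (Derive phi (branch b th (S n) y) / INR b ^ S n - 0)) by (unfold Rdiv; ring).
    apply (is_derive_scal (fun y => phi (branch b th (S n) y) - phi (branch b th (S n) 0))).
    apply (is_derive_minus (fun y => phi (branch b th (S n) y))).
    + apply is_derive_branch; [exact Hb|]. intros; now apply Derive_correct.
    + apply (is_derive_const (phi (branch b th (S n) 0))).
  - intros n y. apply transfer_term_dom; [apply gam_bounds | apply HM1].
  - intros y. apply ex_series_potential.
Qed.

Lemma W_branch (th : nat -> nat) (N : nat) (x : R) :
  W phi lam b x - W phi lam b 0 =
  (/ lam) ^ N * (W phi lam b (branch b th N x) - W phi lam b (branch b th N 0))
  - psum (fun n => potential_term th n x) N.
Proof.
  induction N as [|N IH].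
  - simpl. unfold branch. simpl. unfold Rdiv. rewrite Rinv_1, !Rplus_0_r, !Rmult_1_r. ring.
  - rewrite IH. simpl psum. unfold potential_term.
    (* Multiplying the branch of order N + 1 by b gives the branch of order N plus the integer
       [th N], which the period of [W] absorbs. *)
    assert (Hs : forall y, W phi lam b (branch b th (S N) y) =
              phi (branch b th (S N) y) + lam * W phi lam b (branch b th N y)).
    { intros y. rewrite W_eq. do 2 f_equal.
      rewrite <- (period_nat _ 1 (th N) W_periodic (branch b th N y)). f_equal.
      unfold branch. simpl. rewrite plus_INR, mult_INR, pow_INR.
      generalize (pow_b_pos b Hb N) (INR_b_ge2 b Hb); intros. field; lra. }
    rewrite !Hs. generalize lam_pos; intros. simpl. field. lra.
Qed.

(** In [W_branch] the remainder is at most L |x| lam^(-N) b^(-N) = L |x| gamma^N, so it tends to 0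
    and only the series is left. *)
Lemma Lipschitz_W_potential (th : nat -> nat) (x : R) :
  Lipschitz (W phi lam b) -> W phi lam b x - W phi lam b 0 = potential th x.
Proof.
  intros [L HL]. generalize gam_bounds; intros Hg.
  apply cond_eq. intros eps Heps.
  set (K := L * Rabs x).
  destruct (geom_small (M1 * Rabs x * gam) gam) with (eps := eps / 2) as [N1 HN1]; try lra.
  (* The factor [1 - gam] cancels the denominator in [geom_small], so that |K| gamma^N itself is
     made small. *)
  destruct (geom_small (K * (1 - gam)) gam) with (eps := eps / 2) as [N2 HN2]; try lra.
  assert (Hmono : forall c N m, 0 <= c -> (N <= m)%nat -> c * gam ^ m <= c * gam ^ N).
  { intros c N m Hc Hm. apply Rmult_le_compat_l; [exact Hc|].
    replace m with (N + (m - N))%nat by lia. rewrite pow_add.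
    rewrite <- (Rmult_1_r (gam ^ N)) at 2.
    apply Rmult_le_compat_l; [apply pow_le; lra|].
    rewrite <- (pow1 (m - N)). apply pow_incr; lra. }
  set (N := (N1 + N2)%nat).
  rewrite (W_branch th N x). unfold potential.
  assert (H1 : Rabs (Series (fun n => potential_term th n x)
               - psum (fun n => potential_term th n x) N) < eps / 2).
  { apply Rle_lt_trans with (2 := HN1).
    apply Rle_trans with (Rabs (M1 * Rabs x * gam) / (1 - gam) * gam ^ N).
    - eapply Rle_trans.
      + apply (Series_tail_dom (M1 * Rabs x * gam) gam); try lra.
        intros; apply potential_term_dom.
      + apply Rmult_le_compat_r; [apply pow_le; lra|].
        apply Rmult_le_compat_r; [left; apply Rinv_0_lt_compat; lra | apply Rle_abs].
    - apply Hmono; [|unfold N; lia]. apply Rdiv_le_0_compat; [apply Rabs_pos | lra]. }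
  assert (H2 : Rabs ((/ lam) ^ N *
     (W phi lam b (branch b th N x) - W phi lam b (branch b th N 0))) < eps / 2).
  { apply Rle_lt_trans with (2 := HN2).
    apply Rle_trans with (Rabs (K * (1 - gam)) / (1 - gam) * gam ^ N).
    - rewrite (Rabs_mult K), (Rabs_pos_eq (1 - gam)) by lra.
      replace (Rabs K * (1 - gam) / (1 - gam)) with (Rabs K) by (field; lra).
      assert (Hl : 0 < (/ lam) ^ N) by apply pow_lt, Rinv_0_lt_compat, lam_pos.
      rewrite Rabs_mult, Rabs_pos_eq by lra.
      apply Rle_trans with ((/ lam) ^ N * (K / INR b ^ N)).
      + apply Rmult_le_compat_l; [lra|]. eapply Rle_trans; [apply HL|].
        rewrite branch_sub, Rminus_0_r by exact Hb. unfold K, Rdiv.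
        rewrite Rabs_mult, (Rabs_pos_eq (/ _)); [lra|].
        left; apply Rinv_0_lt_compat, pow_b_pos, Hb.
      + replace ((/ lam) ^ N * (K / INR b ^ N)) with (K * ((/ lam) ^ N / INR b ^ N))
          by (unfold Rdiv; ring).
        rewrite gam_pow. apply Rmult_le_compat_r; [apply pow_le; lra | apply Rle_abs].
    - apply Hmono; [|unfold N; lia]. apply Rdiv_le_0_compat; [apply Rabs_pos | lra]. }
  revert H1 H2. unfold Rabs. repeat destruct Rcase_abs; lra.
Qed.

Lemma Lipschitz_W_Hstar : Lipschitz (W phi lam b) -> cond_Hstar phi lam b.
Proof.
  intros HL i j _ _ x.
  assert (H : forall th, Y phi lam b x th = Derive (W phi lam b) x).
  { intros th. symmetry. apply is_derive_unique.
    apply is_derive_ext with (fun y => potential th y + W phi lam b 0).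
    - intros y. rewrite <- (Lipschitz_W_potential th y HL). simpl. ring.
    - replace (Y phi lam b x th) with (Y phi lam b x th + 0) by ring.
      apply (is_derive_plus (potential th)); [apply is_derive_potential|].
      apply (is_derive_const (W phi lam b 0)). }
  rewrite !H. ring.
Qed.

Definition zero_digits : nat -> nat := fun _ => O.

(** For zero digits the branches are x/b^n, and replacing x by bx shifts their index by one. The
    result is the functional equation of [W] minus its value at 0. *)
Lemma potential_scale (x : R) :
  potential zero_digits x =
  phi x - phi 0 + lam * potential zero_digits (INR b * x).
Proof.
  unfold potential at 2. rewrite Series_incr_1 by apply ex_series_potential.
  assert (Hbr : forall n y, branch b zero_digits (S n) (INR b * y) = branch b zero_digits n y).
  { intros n y. unfold branch, zero_digits. rewrite !expansion_0. simpl.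
    generalize (pow_b_pos b Hb n) (INR_b_ge2 b Hb); intros. field; lra. }
  rewrite (Series_ext (fun k => potential_term zero_digits (S k) (INR b * x))
    (fun k => / lam * potential_term zero_digits k x)).
  - rewrite Series_scal_l. unfold potential_term at 1.
    replace (branch b zero_digits 1 0) with (branch b zero_digits 1 (INR b * 0))
      by (f_equal; ring).
    rewrite !Hbr. unfold potential, branch. simpl. unfold Rdiv.
    rewrite Rinv_1, !Rplus_0_r, !Rmult_1_r. generalize lam_pos; intros. field. lra.
  - intros n. unfold potential_term.
    replace (branch b zero_digits (S (S n)) 0)
      with (branch b zero_digits (S (S n)) (INR b * 0)) by (f_equal; ring).
    rewrite !Hbr. simpl. ring.
Qed.

Lemma potential_0 (th : nat -> nat) : potential th 0 = 0.
Proof.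
  unfold potential. rewrite (Series_ext _ (fun _ => 0 * 0)).
  - rewrite Series_scal_l. ring.
  - intros n. unfold potential_term. ring.
Qed.

(** It suffices to identify [W] minus its value at 0 with [potential zero_digits]: both solve the
    same functional equation, and such a solution is unique among bounded functions. Boundedness of
    the potential comes from its periodicity. *)
Lemma Hstar_W_derive (x : R) :
  cond_Hstar phi lam b -> is_derive (W phi lam b) x (Y phi lam b x zero_digits).
Proof.
  intros HH. set (G := potential zero_digits).
  assert (HG : forall y, is_derive G y (Y phi lam b y zero_digits))
    by (intros; apply is_derive_potential).
  assert (HYper : forall y, Y phi lam b (y + 1) zero_digits = Y phi lam b y zero_digits).
  { intros y. set (e1 := fun n => match n with O => 1%nat | _ => O end).
    transitivity (Y phi lam b y e1).
    - rewrite !Y_transfer by exact Hb. f_equal. apply Series_ext. intros n. do 2 f_equal.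
      unfold branch, zero_digits. rewrite expansion_0.
      replace (expansion b e1 (S n)) with 1%nat; [simpl; f_equal; ring|].
      clear. induction n as [|n IH]; [simpl; lia|].
      change (1 = expansion b e1 (S n) + e1 (S n) * b ^ S n)%nat. simpl e1. lia.
    - apply Rminus_diag_uniq. apply HH.
      + intros n; unfold zero_digits; lia.
      + intros [|n]; simpl; lia. }
  (* The derivative of [G] has period 1, so this increment is constant; its value is read at y = 0,
     where [G] vanishes. *)
  assert (Hshift : forall y, G (y + 1) - G y = G 1).
  { intros y.
    assert (Hd : forall z, is_derive (fun z => G (z + 1) - G z) z 0).
    { intros z. replace 0 with (1 * Y phi lam b (z + 1) zero_digits
        - Y phi lam b z zero_digits) by (rewrite HYper; ring).
      apply (is_derive_minus (fun z => G (z + 1)) G); [|apply HG].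
      apply (is_derive_comp G (fun z => z + 1)); [apply HG|]. auto_derive; auto. }
    destruct (MVT_gen (fun z => G (z + 1) - G z) 0 y (fun _ => 0)) as [c [_ Hc]].
    - intros; apply Hd.
    - intros z _. apply continuity_pt_filterlim.
      apply (ex_derive_continuous (fun z => G (z + 1) - G z)). eexists; apply Hd.
    - unfold G in Hc at 4. rewrite potential_0, Rplus_0_l in Hc. lra. }
  assert (HGn : forall n, G (INR n) = INR n * G 1).
  { induction n as [|n IH]; [unfold G; rewrite potential_0; simpl; ring|].
    rewrite S_INR. specialize (Hshift (INR n)). lra. }
  (* [b G(1) = G(b) = G(1) / lam], while [b lam > 1]. *)
  assert (HG1 : G 1 = 0).
  { generalize (potential_scale 1). fold G. rewrite Rmult_1_r, HGn.
    replace (phi 1) with (phi 0) by (rewrite <- (Hper 0); f_equal; ring).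
    intros E. generalize gam_bounds. unfold gam. intros [_ Hg].
    generalize (INR_b_ge2 b Hb) lam_pos; intros.
    apply Rmult_lt_compat_r with (r := INR b * lam) in Hg; [|nra].
    replace (1 / (INR b * lam) * (INR b * lam)) with 1 in Hg by (field; lra).
    assert (E' : G 1 * (INR b * lam - 1) = 0) by lra.
    apply Rmult_integral in E'. lra. }
  destruct (periodic_bounded G) as [MG HMG].
  { intros y. specialize (Hshift y). lra. }
  { intros y. apply (ex_derive_continuous G). eexists; apply HG. }
  (* The difference D is bounded and satisfies D(y) = lam D(by). *)
  assert (HW : forall y, W phi lam b y - W phi lam b 0 - G y = 0).
  { apply (contraction_zero R (fun y => INR b * y) _ lam
      (2 * (M0 / (1 - lam)) + MG)).
    - generalize lam_pos; lra.
    - intros y. rewrite (W_eq y). unfold G. rewrite (potential_scale y).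
      generalize (W_eq 0). rewrite Rmult_0_r. intros. lra.
    - intros y. generalize (W_bounded y) (W_bounded 0) (HMG y).
      unfold Rabs. repeat destruct Rcase_abs; lra. }
  apply is_derive_ext with (fun y => G y + W phi lam b 0).
  - intros y. specialize (HW y). simpl. lra.
  - replace (Y phi lam b x zero_digits) with (Y phi lam b x zero_digits + 0) by ring.
    apply (is_derive_plus G); [apply HG|]. apply (is_derive_const (W phi lam b 0)).
Qed.

End Weierstrass.

(** * Smoothness *)

Lemma Derive_n_periodic (f : R -> R) (n : nat) : Z_periodic f -> Z_periodic (Derive_n f n).
Proof.
  intros H x. rewrite <- Derive_n_comp_trans. apply Derive_n_ext. exact H.
Qed.

Lemma C_k_continuous (k n : nat) (f : R -> R) (x : R) :
  C_k k f -> (n <= k)%nat -> continuous (Derive_n f n) x.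
Proof.
  intros [H1 H2] Hn. destruct (Nat.eq_dec n k) as [->|E]; [apply H2|].
  apply (ex_derive_continuous (Derive_n f n)). apply H1. lia.
Qed.

Lemma C_k_Derive_bounded (k n : nat) (f : R -> R) :
  Z_periodic f -> C_k k f -> (n <= k)%nat -> exists M, forall x, Rabs (Derive_n f n x) <= M.
Proof.
  intros Hp HC Hn. apply periodic_bounded; [now apply Derive_n_periodic|].
  intros x. now apply (C_k_continuous k).
Qed.

(** The derivative of order m of [Y] is minus the transfer series of weight gamma/b^m applied to the
    derivative of order m + 1 of [phi]. This can be repeated up to m = k. *)
Lemma C_k_of_derive_Y (k b : nat) (lam : R) (phi f : R -> R) (th : nat -> nat) :
  (2 <= b)%nat -> 0 < 1 / (INR b * lam) < 1 ->
  Z_periodic phi -> C_k (S k) phi ->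
  (forall x, is_derive f x (Y phi lam b x th)) -> C_k (S k) f.
Proof.
  intros Hb Hg Hp HC Hf. set (gam := 1 / (INR b * lam)) in *.
  set (H := fun m x => - transfer b (gam / INR b ^ m) (Derive_n phi (S m)) th x).
  assert (Hgm : forall m, 0 < gam / INR b ^ m < 1).
  { intros m. assert (1 <= INR b ^ m) by (apply pow_R1_Rle; generalize (INR_b_ge2 b Hb); lra).
    split; [apply Rdiv_lt_0_compat; lra|].
    apply Rmult_lt_reg_r with (INR b ^ m); [lra|]. unfold Rdiv.
    rewrite Rmult_assoc, Rinv_l; lra. }
  assert (HH : forall m x, (m < k)%nat -> is_derive (H m) x (H (S m) x)).
  { intros m x Hm. apply (is_derive_opp (transfer b (gam / INR b ^ m) (Derive_n phi (S m)) th)).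
    destruct (C_k_Derive_bounded (S k) (S m) phi Hp HC ltac:(lia)) as [M HM].
    destruct (C_k_Derive_bounded (S k) (S (S m)) phi Hp HC ltac:(lia)) as [M' HM'].
    replace (gam / INR b ^ S m) with (gam / INR b ^ m / INR b).
    - apply is_derive_transfer with M M'; auto.
      intros y. apply Derive_correct. apply HC. lia.
    - simpl. generalize (pow_b_pos b Hb m) (INR_b_ge2 b Hb); intros. field. lra. }
  assert (HD : forall m, (m <= k)%nat -> forall x, Derive_n f (S m) x = H m x).
  { induction m as [|m IH]; intros Hm x.
    - change (Derive f x = H O x). rewrite (is_derive_unique f x _ (Hf x)).
      rewrite Y_transfer by exact Hb. unfold H. fold gam. simpl. unfold Rdiv. now rewrite Rinv_1, Rmult_1_r.
    - change (Derive (Derive_n f (S m)) x = H (S m) x).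
      rewrite (Derive_ext _ (H m)) by (intros; apply IH; lia).
      apply is_derive_unique, HH. lia. }
  split.
  - intros [|m] Hm x.
    + eexists; apply Hf.
    + apply (ex_derive_ext (H m)).
      * intros y. symmetry. apply HD. lia.
      * eexists. apply HH. lia.
  - intros x. apply (continuous_ext (H k)).
    + intros y. symmetry. now apply HD.
    + apply (continuous_opp (transfer b (gam / INR b ^ k) (Derive_n phi (S k)) th)).
      destruct (C_k_Derive_bounded (S k) (S k) phi) as [M HM]; auto.
      apply continuous_transfer with M; auto.
      intros y. apply HC.
Qed.

(** * Coincidences between digit sequences *)

Lemma psum_periodic (a : nat -> R) (p c : nat) :
  (forall k, a (p + k)%nat = a k) -> psum a (p * c) = INR c * psum a p.
Proof.
  intros H; induction c as [|c IH].
  - rewrite Nat.mul_0_r; simpl; ring.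
  - rewrite Nat.mul_succ_r, Nat.add_comm, psum_plus, S_INR.
    rewrite (psum_ext (fun k => a (p + k)%nat) a) by (intros; apply H). rewrite IH. ring.
Qed.

Lemma psum_Series (a : nat -> nat -> R) (n : nat) :
  (forall k, ex_series (a k)) ->
  ex_series (fun m => psum (fun k => a k m) n) /\
  psum (fun k => Series (a k)) n = Series (fun m => psum (fun k => a k m) n).
Proof.
  intros H; induction n as [|n [IH1 IH2]]; simpl.
  - split.
    + apply (ex_series_dom 0 0); try lra. intros; rewrite Rabs_R0; lra.
    + symmetry. rewrite (Series_ext _ (fun _ => 0 * 0)) by (intros; ring).
      rewrite Series_scal_l; ring.
  - split.
    + now apply (ex_series_plus (fun m => psum (fun k => a k m) n) (a n)).
    + rewrite IH2, Series_plus; auto.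
Qed.

(** * Averages over integer translates *)

Section Average.
Variable b : nat.
Hypothesis Hb : (2 <= b)%nat.

(** The integers k < b^n are the values of n free digits, so this averages over n digits. Applied to
    z -> h(z/b^n), it is the n-th iterate on h of the normalised transfer operator of x -> bx mod
    1. *)
Definition avg (n : nat) (f : R -> R) (y : R) : R :=
  psum (fun k => f (y + INR k)) (b ^ n) / INR b ^ n.

Lemma avg_bounded (n : nat) (f : R -> R) (M y : R) :
  (forall x, Rabs (f x) <= M) -> Rabs (avg n f y) <= M.
Proof.
  intros H. unfold avg, Rdiv. generalize (pow_b_pos b Hb n). intros Hp.
  rewrite Rabs_mult, (Rabs_pos_eq (/ _)) by (left; now apply Rinv_0_lt_compat).
  apply Rmult_le_reg_r with (INR b ^ n); [exact Hp|].
  rewrite Rmult_assoc, Rinv_l, Rmult_1_r, Rmult_comm, <- pow_INR by lra.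
  apply psum_Rabs. intros; apply H.
Qed.

(** A translation by 1 permutes the translates cyclically: the one that enters and the one that
    leaves differ by the period b^n. *)
Lemma avg_periodic (n : nat) (f : R -> R) : period f (INR b ^ n) -> Z_periodic (avg n f).
Proof.
  intros H y. unfold avg. f_equal.
  rewrite (psum_ext _ (fun k => f (y + INR (S k))))
    by (intros; rewrite S_INR; f_equal; ring).
  rewrite (psum_shift (fun k => f (y + INR k))).
  rewrite pow_INR, H. simpl. rewrite Rplus_0_r. ring.
Qed.

Lemma avg_translate (n m : nat) (f : R -> R) (y : R) :
  period f (INR b ^ n) -> avg n (fun z => f (z + INR m)) y = avg n f y.
Proof.
  intros H. rewrite <- (period_nat _ 1 m (avg_periodic n f H) y). unfold avg. f_equal.
  apply psum_ext. intros; f_equal; ring.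
Qed.

Lemma avg_refine (n m : nat) (f : R -> R) (y : R) :
  period f (INR b ^ n) -> avg (n + m) f y = avg n f y.
Proof.
  intros H. unfold avg. rewrite Nat.pow_add_r, psum_periodic.
  - rewrite pow_INR, pow_add.
    generalize (pow_b_pos b Hb n) (pow_b_pos b Hb m). intros. field; lra.
  - intros k. rewrite plus_INR, pow_INR, <- (H (y + INR k)). f_equal; ring.
Qed.

(** * Mean and conditional means of the transfer series *)

Section Limit.
Variables (g : R) (h : R -> R) (M : R).
Hypothesis Hg : 0 < g < 1.
Hypothesis HM : forall x, Rabs (h x) <= M.
Hypothesis Hh : Z_periodic h.

Definition dilate (n : nat) (z : R) : R := h (z / INR b ^ n).

Lemma dilate_period (n : nat) : period (dilate n) (INR b ^ n).
Proof.
  intros x. unfold dilate. rewrite <- (Hh (x / INR b ^ n)). f_equal.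
  generalize (pow_b_pos b Hb n). intros. field; lra.
Qed.

(* The mean of [transfer] over all digit sequences. *)
Definition mean_transfer (y : R) : R :=
  Series (fun n => g ^ S n * avg (S n) (dilate (S n)) y).

Lemma avg_dilate_bounded (n m : nat) (y : R) : Rabs (avg n (dilate m) y) <= M.
Proof. apply avg_bounded. intros; apply HM. Qed.

Lemma mean_term_dom (n : nat) (c : R) : Rabs c <= M -> Rabs (g ^ S n * c) <= M * g * g ^ n.
Proof.
  intros H. apply (transfer_term_dom g (fun _ => c) M Hg (fun _ => H) n 0).
Qed.

Lemma mean_transfer_bounded (y : R) : Rabs (mean_transfer y) <= M * g / (1 - g).
Proof.
  apply Series_dom; try lra. intros n. apply mean_term_dom, avg_dilate_bounded.
Qed.

Lemma mean_transfer_periodic : Z_periodic mean_transfer.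
Proof.
  intros y. apply Series_ext. intros n. f_equal. apply avg_periodic, dilate_period.
Qed.

Lemma continuous_mean_transfer (y : R) :
  (forall x, continuous h x) -> continuous mean_transfer y.
Proof.
  intros Hc. apply (continuous_Series (M * g) g); try lra.
  - intros n. apply (continuous_scal_r (g ^ S n) (avg (S n) (dilate (S n)))).
    unfold avg, Rdiv.
    apply (continuous_scal_l
      (fun y => psum (fun k => dilate (S n) (y + INR k)) (b ^ S n)) (/ INR b ^ S n)).
    apply (continuous_psum (fun k y => dilate (S n) (y + INR k))). intros k.
    apply (continuous_comp (fun y => (y + INR k) / INR b ^ S n) h); [|apply Hc].
    apply (ex_derive_continuous (fun y => (y + INR k) / INR b ^ S n)). auto_derive. auto.
  - intros n x. apply mean_term_dom, avg_dilate_bounded.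
Qed.

(** For n < N the term of rank n has period b^(n+1), a divisor of b^N, so its average forgets the
    digits and equals the corresponding term of [mean_transfer]. Only ranks n >= N contribute, each
    by at most 2 M g g^n. *)
Lemma avg_transfer (th : nat -> nat) (N : nat) (y : R) :
  Rabs (avg N (transfer b g h th) y - mean_transfer y) <= 2 * M * g / (1 - g) * g ^ N.
Proof.
  set (f := fun n => avg N (fun z => h (branch b th (S n) z)) y).
  assert (Hs : avg N (transfer b g h th) y = Series (fun n => g ^ S n * f n)).
  { unfold avg at 1, transfer.
    rewrite (proj2 (psum_Series
      (fun k n => g ^ S n * h (branch b th (S n) (y + INR k))) (b ^ N)
      (fun k => ex_series_transfer b g h M Hg HM th (y + INR k)))).
    unfold Rdiv. rewrite Rmult_comm, <- Series_scal_l. apply Series_ext. intros n.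
    rewrite psum_scal. unfold f, avg, Rdiv. ring. }
  assert (Hf : forall n, Rabs (f n) <= M) by (intros; apply avg_bounded; intros; apply HM).
  rewrite Hs. unfold mean_transfer. rewrite <- Series_minus.
  2: { apply (ex_series_dom (M * g) g); try lra. intros; now apply mean_term_dom. }
  2: { apply (ex_series_dom (M * g) g); try lra.
       intros; apply mean_term_dom, avg_dilate_bounded. }
  set (a := fun n => g ^ S n * f n - g ^ S n * avg (S n) (dilate (S n)) y).
  assert (Ha : psum a N = 0).
  { rewrite (psum_ext _ (fun _ => 0 * 0)).
    - rewrite psum_scal. ring.
    - intros n Hn. unfold a. rewrite <- Rmult_minus_distr_l.
      replace (f n) with (avg (S n) (dilate (S n)) y); [ring|].
      rewrite <- (avg_refine (S n) (N - S n)) by apply dilate_period.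
      replace (S n + (N - S n))%nat with N by lia.
      unfold f. symmetry. apply (avg_translate N (expansion b th (S n)) (dilate (S n))).
      intros x. replace N with (S n + (N - S n))%nat by lia.
      rewrite pow_add, <- pow_INR with (n := (N - S n)%nat), Rmult_comm.
      apply period_nat, dilate_period. }
  replace (Series a) with (Series a - psum a N) by (rewrite Ha; ring).
  apply Series_tail_dom; try lra. intros n. unfold a.
  apply Rle_trans with (1 := Rabs_triang _ _). rewrite Rabs_Ropp.
  generalize (mean_term_dom n _ (Hf n)) (mean_term_dom n _ (avg_dilate_bounded (S n) (S n) y)).
  lra.
Qed.

Definition partial (s : nat) (z : R) : R := psum (fun n => g ^ S n * dilate (S n) z) s.

Lemma partial_period (s : nat) : period (partial s) (INR b ^ s).
Proof.
  intros z. apply psum_ext. intros n Hn. f_equal.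
  replace s with (S n + (s - S n))%nat by lia.
  rewrite pow_add, <- pow_INR with (n := (s - S n)%nat), Rmult_comm.
  apply period_nat, dilate_period.
Qed.

(** Periodicity of [h] allows the same truncation [expansion b th s] in each of the first [s] terms,
    whose sum thus depends on the point and the digits through one real variable z. *)
Lemma transfer_partial (th : nat -> nat) (s : nat) (x : R) :
  transfer b g h th x =
  partial s (x + INR (expansion b th s)) + g ^ s * transfer b g h (drop_digits th s) (branch b th s x).
Proof.
  rewrite (transfer_split b Hb g h M Hg HM th s). f_equal.
  apply psum_ext. intros n Hn. f_equal. apply branch_truncate; auto.
Qed.

(* The conditional expectation of [transfer] given the first [s] digits. *)
Definition cond_mean (s : nat) (z : R) : R :=
  partial s z + g ^ s * mean_transfer (z / INR b ^ s).

Lemma cond_mean_period_pow (s : nat) : period (cond_mean s) (INR b ^ s).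
Proof.
  intros z. unfold cond_mean. rewrite partial_period. do 2 f_equal.
  rewrite <- (mean_transfer_periodic (z / INR b ^ s)). f_equal.
  generalize (pow_b_pos b Hb s). intros. field; lra.
Qed.

(** The function u of the overview: the martingale increment with its scaling removed. If it is a
    constant c, then [mean_transfer] plus c/(1 - g) solves the recursion of [transfer] for every
    digit sequence. *)
Definition obstruction (y : R) : R := g * (h y + mean_transfer y) - mean_transfer (INR b * y).

Lemma cond_mean_S (s : nat) (z : R) :
  cond_mean (S s) z - cond_mean s z = g ^ s * obstruction (z / INR b ^ S s).
Proof.
  unfold cond_mean, obstruction, partial. simpl psum. unfold dilate.
  replace (INR b * (z / INR b ^ S s)) with (z / INR b ^ s).
  - simpl. ring.
  - simpl. generalize (pow_b_pos b Hb s) (INR_b_ge2 b Hb). intros. field; lra.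
Qed.

Lemma obstruction_periodic : Z_periodic obstruction.
Proof.
  intros y. unfold obstruction. rewrite Hh, mean_transfer_periodic.
  rewrite (Rmult_plus_distr_l (INR b)), (period_nat _ 1 b mean_transfer_periodic). reflexivity.
Qed.

(** * Two digit sequences with the same transfer series *)

Section Coincidence.
Variables i j : nat -> nat.
Hypothesis Hij : forall x, transfer b g h i x = transfer b g h j x.

(** The coincidence is averaged over the translates z + k b^s with k < b^N. As N grows, the averaged
    tails converge to [mean_transfer] whatever their digits. *)
Lemma cond_mean_eq (s : nat) (z : R) :
  cond_mean s (z + INR (expansion b i s)) = cond_mean s (z + INR (expansion b j s)).
Proof.
  set (ei := INR (expansion b i s)). set (ej := INR (expansion b j s)).
  (* A translation by k b^s leaves the first [s] terms unchanged and moves the branch of order [s]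
     by the integer k. *)
  assert (Hk : forall k : nat,
    g ^ s * transfer b g h (drop_digits j s) (branch b j s z + INR k) =
    partial s (z + ei) - partial s (z + ej) +
    g ^ s * transfer b g h (drop_digits i s) (branch b i s z + INR k)).
  { intros k. generalize (Hij (z + INR k * INR b ^ s)).
    rewrite (transfer_partial i s), (transfer_partial j s). fold ei ej.
    assert (Hp : forall e, partial s (z + INR k * INR b ^ s + e) = partial s (z + e)).
    { intros e. rewrite <- (period_nat _ _ k (partial_period s) (z + e)). f_equal; ring. }
    rewrite !Hp.
    assert (Hbr : forall th, branch b th s (z + INR k * INR b ^ s) = branch b th s z + INR k).
    { intros th. unfold branch. generalize (pow_b_pos b Hb s). intros. field; lra. }
    rewrite !Hbr. lra. }
  assert (HN : forall N, partial s (z + ei) - partial s (z + ej) =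
    g ^ s * (avg N (transfer b g h (drop_digits j s)) (branch b j s z) -
             avg N (transfer b g h (drop_digits i s)) (branch b i s z))).
  { intros N. unfold avg.
    generalize (psum_scal
      (fun k => transfer b g h (drop_digits j s) (branch b j s z + INR k)) (g ^ s) (b ^ N)).
    rewrite (psum_ext _ _ _ (fun k _ => Hk k)), psum_affine, pow_INR.
    intros E. generalize (pow_b_pos b Hb N). intros.
    apply Rmult_eq_reg_r with (INR b ^ N); [|lra].
    field_simplify; lra. }
  unfold cond_mean. apply cond_eq. intros eps Heps.
  set (C := 2 * M * g).
  destruct (geom_small C g ltac:(lra) ltac:(lra) (eps / 2)) as [N HN']; [lra|].
  assert (Hgs : 0 < g ^ s <= 1).
  { split; [apply pow_lt; lra|]. rewrite <- (pow1 s). apply pow_incr; lra. }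
  assert (Hb1 : forall th y, Rabs (avg N (transfer b g h th) y - mean_transfer y) < eps / 2).
  { intros th y. apply Rle_lt_trans with (2 := HN').
    apply Rle_trans with (1 := avg_transfer th N y).
    apply Rmult_le_compat_r; [apply pow_le; lra|].
    apply Rmult_le_compat_r; [left; apply Rinv_0_lt_compat; lra | apply Rle_abs]. }
  fold (branch b i s z) (branch b j s z) in *.
  change ((z + ei) / INR b ^ s) with (branch b i s z).
  change ((z + ej) / INR b ^ s) with (branch b j s z).
  specialize (HN N).
  replace (_ - _) with (g ^ s *
    ((avg N (transfer b g h (drop_digits j s)) (branch b j s z) - mean_transfer (branch b j s z)) -
     (avg N (transfer b g h (drop_digits i s)) (branch b i s z) - mean_transfer (branch b i s z))))
    by lra.
  rewrite Rabs_mult, (Rabs_pos_eq (g ^ s)) by lra.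
  generalize (Hb1 (drop_digits i s) (branch b i s z)) (Hb1 (drop_digits j s) (branch b j s z)).
  set (p := avg N _ _ - _). set (p' := avg N _ _ - _). intros H1 H2.
  apply Rle_lt_trans with (1 * Rabs (p' - p)).
  - apply Rmult_le_compat_r; [apply Rabs_pos | lra].
  - revert H1 H2. unfold Rabs. repeat destruct Rcase_abs; lra.
Qed.

(** A representative modulo b^s of the b-adic integer j - i, of absolute value less than b^s when
    [i] and [j] are digit sequences. *)
Definition discrepancy (s : nat) : Z :=
  (Z.of_nat (expansion b j s) - Z.of_nat (expansion b i s))%Z.

Lemma IZR_discrepancy (s : nat) :
  IZR (discrepancy s) = INR (expansion b j s) - INR (expansion b i s).
Proof. unfold discrepancy. now rewrite minus_IZR, <- !INR_IZR_INZ. Qed.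

Lemma discrepancy_S (s : nat) :
  (discrepancy (S s) =
   discrepancy s + (Z.of_nat (j s) - Z.of_nat (i s)) * Z.of_nat b ^ Z.of_nat s)%Z.
Proof.
  unfold discrepancy. simpl. rewrite !Nat2Z.inj_add, !Nat2Z.inj_mul, !Nat2Z.inj_pow. ring.
Qed.

Lemma cond_mean_period (s : nat) : period (cond_mean s) (IZR (discrepancy s)).
Proof.
  intros z. rewrite IZR_discrepancy.
  replace z with (z - INR (expansion b i s) + INR (expansion b i s)) at 2 by ring.
  rewrite cond_mean_eq. f_equal; ring.
Qed.

(** The discrepancy of rank s + 1 is a period of [cond_mean (S s)], and also of [cond_mean s], since
    it differs from the discrepancy of rank s by a multiple of the period b^s. It is thus a period
    of the increment, which is rescaled by b^(s+1). *)
Lemma obstruction_period (s : nat) :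
  period obstruction (IZR (discrepancy s) / IZR (Z.of_nat b ^ Z.of_nat s)).
Proof.
  destruct s as [|s].
  (* At rank 0 the discrepancy is 0 and no increment precedes it. *)
  { replace (_ / _) with (INR 0 * 1) by (change (0 * 1 = 0 / 1); field).
    apply period_nat, obstruction_periodic. }
  assert (HB : forall n, IZR (Z.of_nat b ^ Z.of_nat n) = INR b ^ n).
  { intros n. now rewrite <- pow_IZR, <- INR_IZR_INZ. }
  rewrite HB. intros y.
  assert (Hgs : 0 < g ^ s) by (apply pow_lt; lra).
  apply Rmult_eq_reg_l with (g ^ s); [|lra].
  generalize (pow_b_pos b Hb (S s)). intros HBp.
  replace y with (y * INR b ^ S s / INR b ^ S s) by (field; lra).
  replace (y * INR b ^ S s / INR b ^ S s + IZR (discrepancy (S s)) / INR b ^ S s)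
    with ((y * INR b ^ S s + IZR (discrepancy (S s))) / INR b ^ S s) by (field; lra).
  rewrite <- !cond_mean_S. rewrite cond_mean_period. f_equal.
  rewrite discrepancy_S, plus_IZR, mult_IZR, HB.
  apply (period_plus (cond_mean s)); [apply cond_mean_period | apply period_Z, cond_mean_period_pow].
Qed.

Hypothesis Hi : digit_seq b i.
Hypothesis Hj : digit_seq b j.
Hypothesis Hneq : i <> j.

(** Otherwise b^s divides the discrepancy for all s by [torsion_free]; being smaller than b^s in
    absolute value it is 0, and its successive differences give i = j. *)
Lemma discrepancy_not_divisible (q : Z) :
  (1 <= q)%Z -> exists s, ~ (Z.of_nat b ^ Z.of_nat s | q * discrepancy s)%Z.
Proof.
  intros Hq. apply not_all_ex_not. intros Hdiv. apply Hneq.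
  assert (H0 : forall s, discrepancy s = 0%Z).
  { intros s.
    destruct (torsion_free (Z.of_nat b) _ discrepancy ltac:(lia) discrepancy_S q Hq Hdiv s)
      as [k Hk].
    generalize (expansion_lt b i s Hi) (expansion_lt b j s Hj).
    rewrite <- Nat2Z.inj_pow in Hk. intros Hei Hej.
    unfold discrepancy in *. assert (k = 0)%Z by nia. nia. }
  extensionality s. generalize (discrepancy_S s). rewrite !H0.
  intros E. symmetry in E. rewrite Z.add_0_l in E. apply Z.mul_eq_0 in E.
  destruct E as [E|E]; [lia|].
  assert (0 < Z.of_nat b ^ Z.of_nat s)%Z by (apply Z.pow_pos_nonneg; lia). lia.
Qed.

(** Starting from the period 1, each use of [period_refine] strictly increases the denominator. *)
Lemma obstruction_small_periods (n : nat) :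
  exists q : Z, (Z.of_nat n <= q)%Z /\ (1 <= q)%Z /\ period obstruction (/ IZR q).
Proof.
  induction n as [|n [q [Hn [Hq Hper]]]].
  - exists 1%Z. repeat split; try lia. rewrite Rinv_1. apply obstruction_periodic.
  - destruct (discrepancy_not_divisible q Hq) as [s Hs].
    destruct (period_refine obstruction q (discrepancy s) (Z.of_nat b ^ Z.of_nat s)) as [q' [Hq' Hper']];
      auto using obstruction_period.
    + assert (0 < Z.of_nat b ^ Z.of_nat s)%Z by (apply Z.pow_pos_nonneg; lia). lia.
    + exists q'. repeat split; auto; lia.
Qed.

Lemma transfer_digit_free (th th' : nat -> nat) (x : R) :
  (forall y, continuous h y) -> transfer b g h th x = transfer b g h th' x.
Proof.
  intros Hc.
  assert (Hu : forall y, obstruction y = obstruction 0).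
  { apply constant_of_small_periods; [|apply obstruction_small_periods].
    intros y. unfold obstruction.
    apply (continuous_minus (fun y => g * (h y + mean_transfer y))
      (fun y => mean_transfer (INR b * y))).
    - apply (continuous_scal_r g (fun y => h y + mean_transfer y)).
      apply (continuous_plus h mean_transfer); [apply Hc | now apply continuous_mean_transfer].
    - apply (continuous_comp (fun y => INR b * y) mean_transfer).
      + apply (ex_derive_continuous (fun y => INR b * y)). auto_derive. auto.
      + now apply continuous_mean_transfer. }
  set (c := obstruction 0) in *.
  (* The recursion of [transfer] changes the point and the digits together, so the contraction acts
     on pairs. The shift c/(1 - g) is the one that absorbs the constant c. *)
  assert (HD : forall p : R * (nat -> nat),
    mean_transfer (fst p) + c / (1 - g) - transfer b g h (snd p) (fst p) = 0).
  { apply (contraction_zero _ (fun p => (branch b (snd p) 1 (fst p), drop_digits (snd p) 1)) _ g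
      (M * g / (1 - g) + Rabs (c / (1 - g)) + M * g / (1 - g))); [lra| |].
    - intros [y t]; simpl.
      rewrite (transfer_eq b Hb g h M Hg HM t y).
      generalize (Hu (branch b t 1 y)). unfold obstruction.
      replace (mean_transfer (INR b * branch b t 1 y)) with (mean_transfer y).
      + intros E.
        replace (mean_transfer y) with (g * (h (branch b t 1 y) + mean_transfer (branch b t 1 y)) - c)
          by lra.
        field. lra.
      + rewrite <- (period_nat _ 1 (t 0%nat) mean_transfer_periodic y). f_equal.
        unfold branch. simpl. rewrite Nat.mul_1_r.
        generalize (INR_b_ge2 b Hb). intros. field; lra.
    - intros [y t]; simpl.
      generalize (mean_transfer_bounded y) (transfer_bounded b g h M Hg HM t y).
      unfold Rabs. repeat destruct Rcase_abs; lra. }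
  generalize (HD (x, th)) (HD (x, th')). simpl. lra.
Qed.

End Coincidence.
End Limit.
End Average.

(** * The dichotomy *)

Theorem theoremA (b : nat) (lam : R) (phi : R -> R) :
  (2 <= b)%nat ->
  1 / INR b < lam -> lam < 1 ->
  Z_periodic phi -> C_k 5 phi ->
  let P1 := C_k 5 (W phi lam b) /\ cond_Hstar phi lam b in
  let P2 := ~ Lipschitz (W phi lam b) /\ cond_H phi lam b in
  (P1 /\ ~ P2) \/ (~ P1 /\ P2).
Proof.
  intros Hb Hl1 Hl2 Hp HC P1 P2.
  destruct (C_k_Derive_bounded 5 0 phi Hp HC ltac:(lia)) as [M0 HM0].
  destruct (C_k_Derive_bounded 5 1 phi Hp HC ltac:(lia)) as [M1 HM1].
  assert (Hd : forall x, ex_derive phi x) by exact (proj1 HC 0%nat ltac:(lia)).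
  assert (Hg := gam_bounds b lam Hb Hl1 Hl2).
  destruct (classic (cond_H phi lam b)) as [HH|HH].
  - assert (HS : ~ cond_Hstar phi lam b).
    (* As b >= 2, there are two distinct constant digit sequences, so the two conditions exclude
       each other. *)
    { intros HS. apply (HH (fun _ => 0%nat) (fun _ => 1%nat)).
      - intros n; lia.
      - intros n; lia.
      - intros E. apply (f_equal (fun f => f 0%nat)) in E. discriminate.
      - intros x. apply HS; intros n; lia. }
    right. split; [now intros [_ H]|]. split; [|exact HH].
    intros HL. apply HS. now apply (Lipschitz_W_Hstar b lam phi M0 M1).
  - left. split; [|now intros [_ H]].
    assert (HS : cond_Hstar phi lam b).
    (* The failure of [cond_H] provides a single coincidence, which [transfer_digit_free] spreads to
       all pairs of digit sequences. *)
    { destruct (classic (exists i j, digit_seq b i /\ digit_seq b j /\ i <> j /\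
        forall x, Y phi lam b x j - Y phi lam b x i = 0)) as [[i [j [Hi [Hj [Hn HY]]]]]|Hno].
      - intros t t' _ _ x. rewrite !Y_transfer by exact Hb.
        rewrite (transfer_digit_free b Hb _ (Derive phi) M1 Hg HM1
          (Derive_n_periodic phi 1 Hp) i j) with (th := t) (th' := t'); auto; [ring| |].
        + intros y. specialize (HY y). rewrite !Y_transfer in HY by exact Hb. lra.
        + intros y. apply (C_k_continuous 5 1); auto with arith.
      - exfalso. apply HH. intros i j Hi Hj Hn HY. apply Hno.
        exists i, j. repeat split; assumption. }
    split; [|exact HS].
    (* [Y] involves phi', so it is of class C^4; as [Y] is the derivative of [W], the fifth order is
       recovered. *)
    apply (C_k_of_derive_Y 4 b lam phi _ zero_digits); auto.
    intros x. now apply (Hstar_W_derive b lam phi M0 M1).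
Qed.
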